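(* Let $V$ be a finite set, let $R:V\times V\to 2^V$ be a poset function, let $G_R$ be its underlying digraph, and let $A_{G_R}$ be the all-paths transit function of $G_R$. Then $G_R$ is a directed acyclic graph (DAG) and $R=A_{G_R}$.
   Context: Let $V$ be a finite set. A directed transit function on $V$ is a function $R:V\times V\to 2^V$ satisfying (t0) for all $u,v,w\in V$: if $R(u,w)\neq\emptyset$ and $R(w,v)\neq\emptyset$ then $R(u,v)\neq\emptyset$; (t1) for all $u,v\in V$: if $R(u,v)\neq\emptyset$ then $\{u,v\}\subseteq R(u,v)$; (t3) $R(u,u)=\{u\}$ for all $u\in V$. A poset function is a directed transit function that in addition satisfies (t2a) for all $u,v\in V$: if $R(u,v)\neq\emptyset$ and $u\neq v$ then $R(v,u)=\emptyset$; (tr1) for all $u,v,w\in V$ with $u\neq v$: if $R(u,w)\neq\emptyset$ and $R(w,v)\neq\emptyset$ then $R(u,w)\cup R(w,v)\subseteq R(u,v)$; (tr2) for all $u,v,w\in V$ with $u\neq v$: if $R(u,w)=\emptyset$ or $R(w,v)=\emptyset$ then $w\notin R(u,v)$. The underlying digraph $G_R$ of $R$ has vertex set $V$, and $(x,y)$ is a directed edge of $G_R$ if and only if $x\neq y$ and $R(x,y)=\{x,y\}$. Digraphs are finite, loopless and simple. A directed path from $u$ to $v$ is a sequence $(x_0=u,x_1,\dots,x_n=v)$ of pairwise distinct vertices with each $(x_{i-1},x_i)$ an edge; $n=0$ (a single vertex) is allowed. A DAG is a digraph without directed cycles. For a digraph $G$ with vertex set $V$, the all-paths transit function is $A_G(u,v)=\{x\in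 V\mid x \text{ lies on a directed path from } u \text{ to } v \text{ in } G\}$. *)

(* Defs.v *)
From mathcomp Require Import all_boot.

Set Implicit Arguments.
Unset Strict Implicit.
Unset Printing Implicit Defensive.

Section TransitFunctions.

Variable V : finType.
Implicit Type R : V -> V -> {set V}.

Record directed_transit R : Prop := DirectedTransit {
  transit_t0 : forall u v w : V,
    R u w != set0 -> R w v != set0 -> R u v != set0;
  transit_t1 : forall u v : V, R u v != set0 -> [set u; v] \subset R u v;
  transit_t3 : forall u : V, R u u = [set u]
}.

Record poset_function R : Prop := PosetFunction {
  poset_transit : directed_transit R;
  poset_t2a : forall u v : V, R u v != set0 -> u != v -> R v u = set0;
  poset_tr1 : forall u v w : V, u != v ->
    R u w != set0 -> R w v != set0 -> R u w :|: R w v \subset R u v;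
  poset_tr2 : forall u v w : V, u != v ->
    R u w = set0 \/ R w v = set0 -> w \notin R u v
}.

Definition underlying_digraph R : rel V :=
  fun x y => (x != y) && (R x y == [set x; y]).

End TransitFunctions.

Section Digraphs.

Variable V : finType.
(* A digraph on V is given by its edge relation. *)
Implicit Type e : rel V.

(* One-vertex cycles are not excluded from the quantification, so that a DAG
   is in particular loopless. *)
Definition is_dag e : Prop := forall c : seq V, c != [::] -> ~ ucycle e c.

(* The path (u, x_1, ..., x_n = v) is encoded by u, v and
   p = [:: x_1; ...; x_n]; p = [::] is the one-vertex path. *)
Definition dipath e (u v : V) (p : seq V) : bool :=
  [&& path e u p, uniq (u :: p) & last u p == v].

(* As the vertices of a path are pairwise distinct, bounding the length by
   #|V| is no restriction (see all_pathsP); it makes the quantifier finite. *)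
Definition all_paths e (u v : V) : {set V} :=
  [set x | [exists p : #|V|.-bseq V, dipath e u v p && (x \in u :: p)]].

Lemma all_pathsP e (u v x : V) :
  reflect (exists2 p : seq V, dipath e u v p & x \in u :: p)
          (x \in all_paths e u v).
Proof.
rewrite inE; apply: (iffP existsP) => [[p /andP[]]|[p ep xp]]; first by exists p.
have sz_p : size p <= #|V|.
  have /and3P[_ /andP[_ /card_uniqP <-] _] := ep.
  exact: max_card.
by exists (Bseq sz_p); apply/andP.
Qed.

End Digraphs.

(* Main.v *)
Require Import Defs.
From mathcomp Require Import all_boot.

(** The relation [R u v != set0] is a partial order on [V], and the axioms say
    that [R u v] is its interval between [u] and [v]. The underlying digraph is
    the covering relation of this order: it is acyclic, and in a finite poset
    every interval is swept out by the covering chains between its ends. *)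

Set Implicit Arguments.
Unset Strict Implicit.
Unset Printing Implicit Defensive.

Section PosetFunctions.

Variables (V : finType) (R : V -> V -> {set V}).
Hypothesis hR : poset_function R.

Definition transit_le : rel V := fun u v => R u v != set0.
Definition transit_lt : rel V := fun u v => (u != v) && transit_le u v.

Local Notation le := transit_le.
Local Notation lt := transit_lt.
Local Notation e := (underlying_digraph R).

Lemma transit_le_refl : reflexive le.
Proof.
by move=> u; rewrite /le (transit_t3 (poset_transit hR)) -card_gt0 cards1.
Qed.

Lemma transit_le_trans : transitive le.
Proof. by move=> w u v; apply: transit_t0 (poset_transit hR) _ _ _. Qed.

Lemma transit_le_anti : antisymmetric le.
Proof.
move=> u v /andP[uv vu]; apply/eqP/negPn/negP => neq_uv.
by move: vu; rewrite /le (poset_t2a hR uv neq_uv) eqxx.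
Qed.

Lemma transit_lt_trans : transitive lt.
Proof.
move=> w u v /andP[neq_uw uw] /andP[_ wv].
rewrite /lt (transit_le_trans uw wv) andbT; apply: contra_neq neq_uw => uv.
by apply: transit_le_anti; rewrite uw uv.
Qed.

(** For distinct ends, (tr2) gives the forward inclusion; conversely (t1) puts [w] in [R u w], which
    (tr1) embeds in [R u v]. Equal ends are covered by (t3) and antisymmetry. *)
Lemma in_poset_function u v w : (w \in R u v) = le u w && le w v.
Proof.
have [<-|neq_uv] := eqVneq u v.
  rewrite (transit_t3 (poset_transit hR)) inE.
  apply/eqP/idP => [->|uwu]; first by rewrite transit_le_refl.
  exact/esym/transit_le_anti.
apply/idP/andP => [wuv|[uw wv]].
  split; apply: contraTT wuv => /negPn/eqP R0.
    by apply: (poset_tr2 hR neq_uv); left.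
  by apply: (poset_tr2 hR neq_uv); right.
apply: (subsetP (poset_tr1 hR neq_uv uw wv)); rewrite inE.
have /subsetP-> // := transit_t1 (poset_transit hR) uw.
by rewrite !inE eqxx orbT.
Qed.

Lemma underlying_digraph_lt : subrel e lt.
Proof.
move=> x y /andP[neq_xy /eqP Rxy]; rewrite /lt neq_xy /le Rxy.
by apply/set0Pn; exists x; rewrite !inE eqxx.
Qed.

(** Every edge is a strict step of the order, so a walk is strictly increasing and cannot revisit a
    vertex. Walks can therefore be concatenated freely and remain directed paths. *)
Lemma path_underlying_uniq u p : path e u p -> uniq (u :: p).
Proof.
move=> /(sub_path underlying_digraph_lt) lt_p.
have lt_irr : irreflexive lt by move=> x; rewrite /lt eqxx.
exact: (sorted_uniq transit_lt_trans lt_irr (s := u :: p)).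
Qed.

Lemma path_underlying_le u p x :
  path e u p -> x \in u :: p -> le u x && le x (last u p).
Proof.
elim: p u x => [|y p IHp] u x /=.
  by move=> _; rewrite inE => /eqP->; rewrite transit_le_refl.
case/andP=> /underlying_digraph_lt/andP[_ uy] ep.
rewrite inE => /predU1P[->|/(IHp _ _ ep)/andP[yx ->]].
  rewrite transit_le_refl /=.
  by have /andP[_ /(transit_le_trans uy)] := IHp _ _ ep (mem_head y p).
by rewrite (transit_le_trans uy yx).
Qed.

Lemma underlying_digraph_dag : is_dag e.
Proof.
(* A cycle through [x] is a walk from [x] that ends at [x] again, which repeats [x]. *)
case=> // x p _ /andP[/path_underlying_uniq /andP[]].
by rewrite mem_rcons mem_head.
Qed.

(** Shrinking an interval at either end loses that end, by antisymmetry: [v] is lost if [x = u], and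
    [u] otherwise. This makes the cardinality of [R u v] a measure for induction. *)
Lemma proper_interval_le u v x y :
  le u x -> le x y -> le y v -> (x, y) != (u, v) -> R x y \proper R u v.
Proof.
move=> ux xy yv neq; apply/properP; split.
  apply/subsetP => z; rewrite !in_poset_function => /andP[xz zy].
  by rewrite (transit_le_trans ux xz) (transit_le_trans zy yv).
have uv := transit_le_trans (transit_le_trans ux xy) yv.
have [eq_xu|neq_xu] := eqVneq x u.
  exists v; rewrite in_poset_function ?uv ?transit_le_refl // negb_and.
  apply/orP; right; apply: contra neq => vy.
  by rewrite eq_xu (@transit_le_anti y v) ?yv.
exists u; rewrite in_poset_function ?uv ?transit_le_refl // negb_and.
apply/orP; left; apply: contra neq_xu => xu.
by rewrite (@transit_le_anti x u) ?xu.
Qed.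

Lemma transit_le_path u v : le u v -> exists2 p, path e u p & last u p = v.
Proof.
have [n] := ubnP #|R u v|; elim: n u v => // n IHn u v ltRn uv.
have [<-|neq_uv] := eqVneq u v; first by exists [::].
have [euv|] := boolP (e u v); first by exists [:: v]; rewrite //= euv.
(* Since (t1) gives one inclusion, a non-edge with [u < v] must have some [w] in [R u v] other than
   [u] and [v]; the interval is split there. *)
rewrite /underlying_digraph neq_uv /= eqEsubset.
rewrite (transit_t1 (poset_transit hR) uv) andbT => /subsetPn[w].
rewrite in_poset_function !inE negb_or => /andP[uw wv] /andP[neq_wu neq_wv].
have lt_card x y : le u x -> le x y -> le y v -> (x, y) != (u, v) ->
    #|R x y| < n.
  move=> ux xy yv /(proper_interval_le ux xy yv)/proper_card ltR.
  exact: leq_trans ltR _.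
have lt_uw : #|R u w| < n.
  apply: lt_card; rewrite ?transit_le_refl //.
  by rewrite xpair_eqE negb_and neq_wv orbT.
have lt_wv : #|R w v| < n.
  apply: lt_card; rewrite ?transit_le_refl //.
  by rewrite xpair_eqE negb_and neq_wu.
have [p ep lp] := IHn u w lt_uw uw.
have [q eq lq] := IHn w v lt_wv wv.
by exists (p ++ q); rewrite ?cat_path ?last_cat lp ?ep.
Qed.

End PosetFunctions.

Theorem theorem11 (V : finType) (R : V -> V -> {set V}) (hR : poset_function R) :
  is_dag (underlying_digraph R) /\
  (forall u v : V, R u v = all_paths (underlying_digraph R) u v).
Proof.
split=> [|u v]; first exact: underlying_digraph_dag.
apply/setP => w; rewrite in_poset_function //.
apply/andP/all_pathsP => [[uw wv]|[p /and3P[ep _ /eqP<-] wp]]; last first.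
  exact/andP/path_underlying_le.
have [p ep lp] := transit_le_path hR uw.
have [q eq lq] := transit_le_path hR wv.
(* Gluing at [w] gives a walk from [u] to [v] through [w]; its vertices are distinct by acyclicity
   of the order. *)
have epq : path (underlying_digraph R) u (p ++ q) by rewrite cat_path ep lp.
exists (p ++ q).
  by rewrite /dipath epq (path_underlying_uniq hR epq) last_cat lp lq eqxx.
by rewrite -cat_cons mem_cat -{1}lp mem_last.
Qed.
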